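(* Let $n\geq 5$. If every graph in $\mathcal{GAQ}_{n-1}$ has fractional strong matching preclusion number $2n-3$, then every graph in $\mathcal{GAQ}_n$ has fractional strong matching preclusion number $2n-1$.
   Context: The $n$-dimensional augmented cube $AQ_n$ ($n\geq 1$) has vertex set all binary strings $u_1u_2\cdots u_n$. $AQ_1\cong K_2$ on vertices $0,1$. For $n\geq 2$, $AQ_n$ consists of a copy $AQ^0_{n-1}$ of $AQ_{n-1}$ with $0$ prefixed to every label and a copy $AQ^1_{n-1}$ with $1$ prefixed, plus the following edges: $0u_1\cdots u_{n-1}$ is adjacent to $1v_1\cdots v_{n-1}$ iff either $u_i=v_i$ for all $i$ (cross edge) or $u_i\neq v_i$ for all $i$ (complement edge). Generalized augmented cubes: $\mathcal{GAQ}_4=\{AQ_4\}$; for $n\geq 5$, $\mathcal{GAQ}_n$ consists of all graphs $(V_1\cup V_2, E_1\cup E_2\cup M_1\cup M_2)$ where $(V_1,E_1),(V_2,E_2)$ are (vertex-disjoint copies of, possibly identical) graphs in $\mathcal{GAQ}_{n-1}$ and $M_1,M_2$ are edge-disjoint perfect matchings between $V_1$ and $V_2$; such graphs are $(2n-1)$-regular on $2^n$ vertices. A fractional perfect matching of a graph $G$ is a function $f:E(G)\to[0,1]$ with $\sum_{e\ni v} f(e)=1$ for every vertex $v$. A fractional strong matching preclusion set of $G$ is a set $F\subseteq V(G)\cup E(G)$ such that $G-F$ (delete the vertices and edges of $F$) has no fractional perfect matching; the fractional strong matching preclusion number $fsmp(G)$ is the minimum size of such a set. *)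

(* Defs.v *)
From HB Require Import structures.
From mathcomp Require Import all_boot all_order all_algebra.
Set Implicit Arguments. Unset Strict Implicit. Unset Printing Implicit Defensive.
Import Order.TTheory GRing.Theory Num.Theory.

(* Simple graphs are given by a vertex finType T and an adjacency relation
   e : rel T (all graphs below are symmetric and irreflexive). *)

(* Adjacency in the augmented cube, on binary strings (seq bool), following
   the recursive definition: AQ_1 = K_2; in AQ_n, 0u ~ 0v iff u ~ v in AQ_{n-1}
   (same for prefix 1), and 0u ~ 1v iff u = v (cross edge) or u, v differ in
   every position (complement edge). *)
Fixpoint aq_adj (u v : seq bool) : bool :=
  match u, v with
  | [:: a], [:: b] => a != b
  | a :: u', b :: v' =>
      if a == b then aq_adj u' v'
      else (u' == v') || all2 (fun x y => x != y) u' v'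
  | _, _ => false
  end.

Definition AQ (n : nat) : rel (n.-tuple bool) := fun x y => aq_adj x y.
Arguments AQ n : clear implicits.

Definition graph_iso (T1 T2 : finType) (e1 : rel T1) (e2 : rel T2) : Prop :=
  exists f : T1 -> T2, bijective f /\ forall x y, e2 (f x) (f y) = e1 x y.

Definition gaq_join (T1 T2 : finType) (e1 : rel T1) (e2 : rel T2)
    (m1 m2 : T1 -> T2) : rel (T1 + T2)%type :=
  fun a b =>
    match a, b with
    | inl x, inl y => e1 x y
    | inr x, inr y => e2 x y
    | inl x, inr y => (y == m1 x) || (y == m2 x)
    | inr y, inl x => (y == m1 x) || (y == m2 x)
    end.

(* GAQ n T e : the graph (T, e) belongs to the class GAQ_n (up to relabelling
   of vertices).  M1, M2 edge-disjoint perfect matchings between V1 and V2 are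
   given by bijections m1, m2 : V1 -> V2 with m1 x <> m2 x for all x. *)
Unset Implicit Arguments.
Inductive GAQ : nat -> forall T : finType, rel T -> Prop :=
| GAQ_base (T : finType) (e : rel T) :
    graph_iso e (AQ 4) -> GAQ 4 T e
| GAQ_step (n : nat) (T T1 T2 : finType) (e : rel T) (e1 : rel T1) (e2 : rel T2)
    (m1 m2 : T1 -> T2) :
    5 <= n -> GAQ n.-1 T1 e1 -> GAQ n.-1 T2 e2 ->
    bijective m1 -> bijective m2 -> (forall x, m1 x != m2 x) ->
    graph_iso e (gaq_join e1 e2 m1 m2) -> GAQ n T e.
Set Implicit Arguments.

(* A set F ⊆ V ∪ E is given by a vertex set FV and a set FE of edges, each
   edge represented as the 2-element vertex set {x, y}. *)
Definition is_edge_set (T : finType) (e : rel T) (FE : {set {set T}}) : Prop :=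
  forall A, A \in FE -> exists x y, e x y /\ A = [set x; y].

Definition del_adj (T : finType) (e : rel T) (FV : {set T}) (FE : {set {set T}})
    : rel T :=
  fun x y => [&& e x y, x \notin FV, y \notin FV & [set x; y] \notin FE].

Definition has_fpm (R : realFieldType) (T : finType) (e : rel T)
    (FV : {set T}) (FE : {set {set T}}) : Prop :=
  exists f : T -> T -> R,
    (forall x y, f x y = f y x) /\
    (forall x y, del_adj e FV FE x y -> (0 <= f x y <= 1)%R) /\
    (forall x, x \notin FV -> (\sum_(y | del_adj e FV FE x y) f x y)%R = 1%R).

Definition fsmp_set (R : realFieldType) (T : finType) (e : rel T)
    (FV : {set T}) (FE : {set {set T}}) : Prop :=
  is_edge_set e FE /\ ~ has_fpm R e FV FE.

Definition fsmp_eq (R : realFieldType) (T : finType) (e : rel T) (k : nat) : Prop :=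
  (exists FV FE, fsmp_set R e FV FE /\ #|FV| + #|FE| = k) /\
  (forall FV FE, fsmp_set R e FV FE -> k <= #|FV| + #|FE|).

(* Main.v *)
Require Import Defs.
From HB Require Import structures.
From mathcomp Require Import all_boot all_order all_algebra.
From mathcomp Require Import zify.

(** By Hall's theorem on the bipartite double cover, a graph has a fractional
    perfect matching iff [#|A| <= #|N(A)|] for every vertex set [A], and it is
    enough to test independent [A].

    Put [k = 2n - 4].  Each half of the graph satisfies Hall's condition after
    any [k] faults.  If both halves carry at most [k] of the (at most [k + 2])
    faults, Hall's condition for the whole graph follows by adding up.
    Otherwise one half [V] carries at least [k + 1] faults, so at most one fault
    lies elsewhere.  Let [I] be independent.
    - If [I] meets the other half, spending the unused faults there on
      neighbours of [I] shows that [I] expands by [k] minus at most one in it,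
      which compensates the loss of at most [2] per excess fault in [V].
    - If [I] lies in [V], one of the two perfect matchings sends [I] injectively
      into [N(I)], unless the outside fault is a vertex and [N(I)] misses [V].
      Then [#|I| >= 2], and restoring a single fault of [V] must create
      [#|I|] neighbours of [I]: the fault cannot be a vertex, and if it is an
      edge then it equals [I], so that [V] contains only one fault. *)

Set Implicit Arguments.
Unset Strict Implicit.
Unset Printing Implicit Defensive.
Import Order.TTheory GRing.Theory Num.Theory.

(** * Hall's theorem *)

Lemma exists_subset_card (T : finType) (A : {set T}) m :
  m <= #|A| -> exists2 D : {set T}, D \subset A & #|D| = m.
Proof.
move=> le_mA; exists [set x in take m (enum A)].
  by apply/subsetP=> x; rewrite inE => /mem_take; rewrite mem_enum.
rewrite cardsE; have /card_uniqP-> : uniq (take m (enum A)).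
  by rewrite take_uniq ?enum_uniq.
by rewrite size_takel // -cardE.
Qed.

(** Induction on [#|D|]. If a nonempty proper subset [A] is tight, [A] and [D :\: A] are matched
    separately, the latter avoiding [NA]. Otherwise every nonempty proper subset has a spare
    neighbour, so one vertex may take any of its neighbours. [u0] provides a function when [D] is
    empty. *)
Lemma hall (T U : finType) (u0 : U) (D : {set T}) (F : T -> {set U}) :
  (forall A : {set T}, A \subset D -> #|A| <= #|\bigcup_(x in A) F x|) ->
  exists f : T -> U, {in D &, injective f} /\ {in D, forall x, f x \in F x}.
Proof.
have [m] := ubnP #|D|; elim: m => // m IHm in D F *; rewrite ltnS => leDm hallD.
have [D0 | [x xD]] := set_0Vmem D.
  by exists (fun=> u0); split=> [x y|x]; rewrite D0 inE.
have [/existsP[A /and3P[ltAD A_neq0 tightA]] | noTight] :=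
  boolP [exists A : {set T}, [&& A \proper D, A != set0
                               & #|\bigcup_(z in A) F z| <= #|A|]].
  have sAD := proper_sub ltAD; set NA := \bigcup_(z in A) F z in tightA.
  have [|B sBA|f1 [f1_inj f1F]] := IHm A F.
  - exact: leq_trans (proper_card ltAD) leDm.
  - exact: hallD (subset_trans sBA sAD).
  have [|B sB|f2 [f2_inj f2F]] := IHm (D :\: A) (fun z => F z :\: NA).
  - rewrite cardsD (setIidPr sAD); have := subset_leq_card sAD.
    by move: A_neq0; rewrite -card_gt0; lia.
  (* [A :|: B] has at least [#|A| + #|B|] neighbours, and [NA] accounts for at most [#|A|] of
     them. *)
  - have [sBD disBA] : B \subset D /\ [disjoint A & B].
      by move: sB; rewrite subsetD disjoint_sym => /andP.
    have := hallD (A :|: B); rewrite subUset sAD sBD => /(_ isT).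
    rewrite cardsU (disjoint_setI0 disBA) cards0 subn0.
    have : \bigcup_(z in A :|: B) F z
             \subset NA :|: \bigcup_(z in B) (F z :\: NA).
      apply/bigcupsP=> z; rewrite inE => /orP[zA|zB]; apply/subsetP=> y yFz.
        by rewrite inE; apply/orP; left; apply/bigcupP; exists z.
      rewrite inE; have [_ //|yNA] := boolP (y \in NA).
      by apply/bigcupP; exists z; rewrite // inE yNA.
    move=> /subset_leq_card; rewrite cardsU; lia.
  have f1NA z : z \in A -> f1 z \in NA by move=> zA; apply/bigcupP; exists z; auto.
  have f2NA z : z \in D -> z \notin A -> (f2 z \notin NA) && (f2 z \in F z).
    by move=> zD zA; rewrite -in_setD f2F // inE zA.
  exists (fun z => if z \in A then f1 z else f2 z); split=> [y z yD zD | z zD].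
    case: ifPn => yA; case: ifPn => zA eqf.
    + exact: f1_inj.
    + by have /andP[] := f2NA z zD zA; rewrite -eqf f1NA.
    + by have /andP[] := f2NA y yD yA; rewrite eqf f1NA.
    + by apply: f2_inj eqf; rewrite inE ?yA ?zA.
  by case: ifPn => zA; [apply: f1F | have /andP[] := f2NA z zD zA].
have [y yFx] : exists y, y \in F x.
  apply/set0Pn; rewrite -card_gt0; have := hallD [set x].
  by rewrite sub1set xD cards1 big_set1 => /(_ isT).
have [|B sB|f [f_inj fF]] := IHm (D :\ x) (fun z => F z :\ y).
- by move: leDm; rewrite (cardsD1 x D) xD.
- have [->|B_neq0] := eqVneq B set0; first by rewrite cards0.
  move: sB; rewrite subsetD1 => /andP[sBD xB].
  have ltBD : B \proper D by rewrite properE sBD; apply/subsetPn; exists x.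
  have : #|B| < #|\bigcup_(z in B) F z|.
    rewrite ltnNge; apply: contra noTight => tightB.
    by apply/existsP; exists B; apply/and3P.
  have : \bigcup_(z in B) F z \subset y |: \bigcup_(z in B) (F z :\ y).
    apply/bigcupsP=> z zB; apply/subsetP=> w wFz; rewrite !inE.
    have [//|w_neq_y] := eqVneq w y.
    by apply/bigcupP; exists z; rewrite // !inE w_neq_y.
  move=> /subset_leq_card; rewrite cardsU1; lia.
have fP z : z \in D -> z != x -> (f z != y) && (f z \in F z).
  by move=> zD zx; rewrite -in_setD1 fF // !inE zx.
exists (fun z => if z == x then y else f z); split=> [z w zD wD | z zD].
  case: eqVneq => [-> | zx]; case: eqVneq => [-> | wx] // eqf.
  + by have := fP w wD wx; rewrite -eqf eqxx.
  + by have := fP z zD zx; rewrite eqf eqxx.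
  + by apply: f_inj eqf; rewrite !inE ?zx ?wx.
by case: eqVneq => [-> // | zx]; have /andP[] := fP z zD zx.
Qed.

(** * Fractional perfect matchings and Hall's condition *)

Definition nbr (T : finType) (r : rel T) (A : {set T}) : {set T} :=
  [set y | [exists x in A, r x y]].

Lemma nbrP (T : finType) (r : rel T) (A : {set T}) y :
  reflect (exists2 x, x \in A & r x y) (y \in nbr r A).
Proof. by rewrite inE; apply: exists_inP. Qed.

Lemma del_adj_sym (T : finType) (e : rel T) FV FE :
  symmetric e -> symmetric (del_adj e FV FE).
Proof.
by move=> e_sym x y; rewrite /del_adj e_sym setUC; case: (x \in FV);
   rewrite ?andbF.
Qed.

Section FractionalMatching.
Variables (R : realFieldType) (T : finType) (e : rel T).
Hypothesis e_sym : symmetric e.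
Variables (FV : {set T}) (FE : {set {set T}}).
Notation r := (del_adj e FV FE).

(** Double counting: the weights leaving the vertices of [A] total [#|A|], and each neighbour
    absorbs at most [1]. *)
Lemma fpm_hall (A : {set T}) :
  has_fpm R e FV FE -> A \subset ~: FV -> #|A| <= #|nbr r A|.
Proof.
case=> f [f_sym [f01 f1]] sA; have r_sym := del_adj_sym FV FE e_sym.
rewrite -(ler_nat R) -!sumr_const.
have -> : (\sum_(x in A) 1 = \sum_(x in A) \sum_(y | r x y) f x y :> R)%R.
  by apply: eq_bigr => x /(subsetP sA); rewrite inE => /f1.
rewrite (exchange_big_dep (mem (nbr r A))) /=; last first.
  by move=> x y xA rxy; apply/nbrP; exists x.
apply: ler_sum => y /nbrP[z _ /and4P[_ _ yFV _]].
rewrite -(f1 y yFV) big_mkcondl /=.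
rewrite [leRHS](eq_bigl (fun x => r x y)); last by move=> x; rewrite r_sym.
apply: ler_sum => x rxy; rewrite f_sym; case: ifP => // _.
by have /andP[] : (0 <= f y x <= 1)%R by apply: f01; rewrite r_sym.
Qed.

(** Hall's theorem on the bipartite double cover gives an injection [s] that moves every live vertex
    along a surviving edge, hence a permutation of the live vertices. *)
Lemma hall_fpm :
  (forall A : {set T}, A \subset ~: FV -> #|A| <= #|nbr r A|) ->
  has_fpm R e FV FE.
Proof.
move=> hallA; have r_sym := del_adj_sym FV FE e_sym.
have [D0|[t0 _]] := set_0Vmem (~: FV).
  exists (fun _ _ => 0%R); split=> //; split=> [x y _|x xFV].
    by rewrite lexx ler01.
  by have := in_set0 x; rewrite -D0 inE xFV.
have [A sA|s [s_inj sr]] :=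
  @hall T T t0 (~: FV) (fun x => [set y | r x y]).
  apply: leq_trans (hallA A sA) (subset_leq_card _); apply/subsetP=> y.
  by case/nbrP=> x xA rxy; apply/bigcupP; exists x; rewrite // inE.
have {}sr x : x \notin FV -> r x (s x) by have := sr x; rewrite !inE.
have imD : s @: (~: FV) = ~: FV.
  apply/eqP; rewrite eqEcard card_in_imset // leqnn andbT.
  by apply/subsetP=> _ /imsetP[x xD ->]; move: xD; rewrite !inE => /sr/and4P[].
(* Each vertex receives one half from its image and one half from its preimage under [s]; where
   these coincide the edge has weight [1]. *)
exists (fun x y => ((s x == y)%:R + (s y == x)%:R) / 2%:R)%R; split=> [x y|].
  by rewrite addrC.
split=> [x y _|x xFV].
  rewrite divr_ge0 ?addr_ge0 ?ler0n //= ler_pdivrMr ?ltr0n // mul1r -natrD.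
  by rewrite ler_nat; do 2!case: (_ == _).
rewrite -mulr_suml big_split /=.
have [y0 y0D xE] : exists2 y, y \in ~: FV & x = s y.
  by apply/imsetP; rewrite imD inE.
have rxy0 : r x y0.
  by rewrite r_sym xE; apply: sr; rewrite inE in y0D.
rewrite (bigD1 (s x)) ?sr //= eqxx big1; last first.
  by move=> y /andP[_ /negPf]; rewrite eq_sym => ->.
rewrite (bigD1 y0) //= -xE eqxx big1; last first.
  move=> y /andP[/and4P[_ _ yFV _] /eqP yy0]; case: eqP => // syx.
  by case: yy0; apply: s_inj => //; [rewrite inE | rewrite syx].
by rewrite !addr0 -[(1 + 1)%R]/(2%:R)%R divff // pnatr_eq0.
Qed.

End FractionalMatching.

(** The set [I] of vertices of [A] outside [nbr r A] is independent, and its neighbours avoid [A].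
    Adding [A :&: nbr r A] to both sides of the inequality for [I] gives the one for [A]. *)
Lemma hall_indep (T : finType) (r : rel T) (D A : {set T}) :
  symmetric r ->
  (forall I : {set T}, I \subset D -> [disjoint I & nbr r I] ->
     #|I| <= #|nbr r I|) ->
  A \subset D -> #|A| <= #|nbr r A|.
Proof.
move=> r_sym indep sAD; set I := A :\: nbr r A.
have sNI : nbr r I \subset nbr r A :\: A.
  apply/subsetP=> y /nbrP[x /setDP[xA xNA] rxy].
  rewrite in_setD; apply/andP; split; last by apply/nbrP; exists x.
  by apply: contra xNA => yA; apply/nbrP; exists y; rewrite // r_sym.
have : #|I| <= #|nbr r I|.
  apply: indep; first exact: subset_trans (subsetDl _ _) sAD.
  rewrite disjoint_sym; apply: disjointWl sNI _.
  by apply: disjointWr (subsetDl _ _) _; rewrite disjoints_subset subsetDr.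
have := subset_leq_card sNI; have := cardsID (nbr r A) A.
have := cardsID A (nbr r A); rewrite -/I setIC; lia.
Qed.

(** * Faults inside a set of vertices *)

(** Faulty edges leaving [U] do not count: they join no two vertices of [U]. *)
Definition faults (T : finType) (U FV : {set T}) (FE : {set {set T}}) :=
  #|FV :&: U| + #|[set E in FE | E \subset U]|.

(** Hall's form of the statement that the subgraph induced on [U] survives any [k] faults. It is
    phrased in the ambient graph so that both halves share the same [FV] and [FE]. *)
Definition robust (T : finType) (e : rel T) (k : nat) (U : {set T}) :=
  forall (FV : {set T}) (FE : {set {set T}}) (A : {set T}),
    is_edge_set e FE -> faults U FV FE <= k -> A \subset U :\: FV ->
    #|A| <= #|nbr (del_adj e FV FE) A :&: U|.

Section Robust.
Variables (T : finType) (e : rel T) (k : nat) (U : {set T}).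
Hypothesis robustU : robust e k U.
Variables (FV : {set T}) (FE : {set {set T}}).
Hypothesis edgeFE : is_edge_set e FE.
Notation N := (nbr (del_adj e FV FE)).

Lemma card_edge E : E \in FE -> #|E| <= 2.
Proof. by case/edgeFE=> x [y [_ ->]]; rewrite cards2; case: (x != y). Qed.

Lemma edge_setD1 E : is_edge_set e (FE :\ E).
Proof. by move=> E'; rewrite inE => /andP[_ /edgeFE]. Qed.

Lemma faultsD1v w :
  w \in FV :&: U -> faults U FV FE = (faults U (FV :\ w) FE).+1.
Proof. by move=> wFV; rewrite /faults (cardsD1 w) wFV setIDAC. Qed.

Lemma faultsD1e E : E \in FE -> E \subset U ->
  faults U FV FE = (faults U FV (FE :\ E)).+1.
Proof.
move=> EFE sEU; rewrite /faults -addnS; congr (_ + _).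
rewrite (cardsD1 E) inE EFE sEU; congr _.+1.
by apply: eq_card => E'; rewrite !inE andbA.
Qed.

Lemma nbrD1v w (A : {set T}) :
  w \notin A -> nbr (del_adj e (FV :\ w) FE) A \subset w |: N A.
Proof.
move=> wA; apply/subsetP=> y /nbrP[x xA]; rewrite /del_adj !inE.
have [->//|yw] := eqVneq y w.
have -> : (x == w) = false by apply: contraNF wA => /eqP <-.
by move=> rxy; apply/exists_inP; exists x.
Qed.

Lemma nbrD1e E (A : {set T}) y : y \in nbr (del_adj e FV (FE :\ E)) A ->
  y \in N A \/ exists2 x, x \in A & E = [set x; y].
Proof.
case/nbrP=> x xA /and4P[exy xFV yFV]; rewrite !inE negb_and negbK.
have [<- _|_ /= xyFE] := eqVneq; first by right; exists x.
by left; apply/exists_inP; exists x; rewrite // /del_adj exy xFV yFV.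
Qed.

Lemma robust_expand (I : {set T}) : faults U FV FE <= k ->
  I \subset U :\: FV -> [disjoint I & N I] -> I != set0 ->
  #|I| + (k - faults U FV FE) <= #|N I :&: U|.
Proof.
move=> lek sI disI I_neq0; set N0 := N I :&: U.
have [D sDN cardD] := exists_subset_card (geq_minr (k - faults U FV FE) #|N0|).
have [sDNI sDU] : D \subset N I /\ D \subset U.
  by move: sDN; rewrite subsetI => /andP.
have disDI : [disjoint D & I].
  by rewrite disjoint_sym; apply: disjointWr disI.
have : #|I| <= #|nbr (del_adj e (FV :|: D) FE) I :&: U|.
  apply: robustU => //; last by rewrite -setDDl subsetD sI disjoint_sym.
  rewrite /faults setIUl; have := leq_card_setU (FV :&: U) (D :&: U).
  rewrite (setIidPl sDU) cardD; move: lek; rewrite /faults => lek [le _].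
  move: le lek; rewrite /=; lia.
have : nbr (del_adj e (FV :|: D) FE) I :&: U \subset N0 :\: D.
  apply/subsetP=> y /setIP[/nbrP[x xI] /and4P[exy]]; rewrite !inE !negb_or.
  case/andP=> xFV _ /andP[yFV yD] xyFE yU; rewrite yD yU andbT.
  by apply/exists_inP; exists x; rewrite // /del_adj exy xFV yFV.
move=> /subset_leq_card; rewrite cardsD (setIidPr sDN) cardD.
move: I_neq0; rewrite -card_gt0; lia.
Qed.

End Robust.

(** Induction on the excess: restoring a faulty vertex adds at most that vertex to the neighbourhood
    of [A], and restoring a faulty edge at most its two ends. *)
Lemma robust_excess (T : finType) (e : rel T) k (U : {set T}) j FV FE
    (A : {set T}) :
  robust e k U -> is_edge_set e FE -> faults U FV FE <= k + j ->
  A \subset U :\: FV -> #|A| <= #|nbr (del_adj e FV FE) A :&: U| + 2 * j.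
Proof.
move=> robustU; elim: j => [|j IHj] in FV FE * => edgeFE.
  by rewrite !addn0; apply: robustU.
move=> lekj sA; have [lek|] := leqP (faults U FV FE) k.
  by apply: leq_trans (robustU FV FE A edgeFE lek sA) (leq_addr _ _).
have [w /= wFV _|no_v] := pickP (mem (FV :&: U)).
  have wA : w \notin A.
    apply/negP=> /(subsetP sA); case/setDP=> _.
    by case/setIP: wFV => ->.
  have /IHj : faults U (FV :\ w) FE <= k + j.
    by move: lekj; rewrite (faultsD1v _ wFV); lia.
  move=> /(_ edgeFE) le; apply: leq_trans (le _) _.
    exact: subset_trans sA (setDS _ (subsetDl _ _)).
  have : nbr (del_adj e (FV :\ w) FE) A :&: U
           \subset w |: (nbr (del_adj e FV FE) A :&: U).
    by rewrite setUIr; apply: setISS; [apply: nbrD1v | apply: subsetUr].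
  by move=> /subset_leq_card; rewrite cardsU1; case: (_ \notin _); lia.
have [E |no_e] := pickP (mem [set E in FE | E \subset U]); last first.
  by rewrite /faults (eq_card0 no_v) (eq_card0 no_e).
rewrite !inE => /andP[EFE sEU] _.
have /IHj : faults U FV (FE :\ E) <= k + j.
  by move: lekj; rewrite (faultsD1e _ EFE sEU); lia.
move=> /(_ (edge_setD1 (E := E) edgeFE)) /(_ sA) le; apply: leq_trans le _.
have : nbr (del_adj e FV (FE :\ E)) A :&: U
         \subset E :|: (nbr (del_adj e FV FE) A :&: U).
  apply/subsetP=> y /setIP[/nbrD1e[yN|[x _ ->]] yU].
    by rewrite in_setU in_setI yN yU orbT.
  by rewrite !inE eqxx orbT.
move=> /subset_leq_card; rewrite cardsU; have := card_edge edgeFE EFE; lia.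
Qed.

(** * Splitting faults and neighbourhoods between two complementary halves *)

Lemma faults_split (T : finType) (e : rel T) (V FV : {set T}) FE :
  is_edge_set e FE ->
  faults V FV FE + faults (~: V) FV FE
    + #|[set E in FE | ~~ (E \subset V) & ~~ (E \subset ~: V)]|
  = #|FV| + #|FE|.
Proof.
move=> edgeFE; rewrite -(cardsID V FV) -(cardsID [set E : {set T} | E \subset V] FE).
rewrite -(cardsID [set E : {set T} | E \subset ~: V] (FE :\: _)) /faults (setDE FV).
have -> : FE :&: [set E : {set T} | E \subset V] = [set E in FE | E \subset V].
  by apply/setP=> E; rewrite !inE.
have -> : (FE :\: [set E : {set T} | E \subset V]) :&: [set E : {set T} | E \subset ~: V]
          = [set E in FE | E \subset ~: V].
  (* A faulty edge has an endpoint, so it cannot lie inside both halves. *)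
  apply/setP=> E; rewrite !inE; have [/edgeFE[x [y [_ ->]]]|_] := boolP (_ \in _).
    by rewrite !subUset !sub1set !inE; case: (x \in V); rewrite ?andbF.
  by rewrite andbF.
have -> : (FE :\: [set E : {set T} | E \subset V]) :\: [set E : {set T} | E \subset ~: V]
          = [set E in FE | ~~ (E \subset V) & ~~ (E \subset ~: V)].
  by apply/setP=> E; rewrite !inE; case: (E \in FE); rewrite ?andbF // andbT andbC.
by rewrite -!addnA; congr (_ + _); apply: addnCA.
Qed.

Lemma card_disjoint_sub (T : finType) (A B C : {set T}) :
  A \subset C -> B \subset C -> [disjoint A & B] -> #|A| + #|B| <= #|C|.
Proof.
move=> sA sB dis; have : A :|: B \subset C by rewrite subUset sA.
by move=> /subset_leq_card; rewrite cardsU (disjoint_setI0 dis) cards0 subn0.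
Qed.

Lemma leq_card_nbr_halves (T : finType) (r : rel T) (V I : {set T}) :
  #|nbr r (I :&: V) :&: V| + #|nbr r (I :&: ~: V) :&: ~: V| <= #|nbr r I|.
Proof.
have sub (J : {set T}) : nbr r (I :&: J) \subset nbr r I.
  by apply/subsetP=> y /nbrP[x /setIP[xI _] rxy]; apply/nbrP; exists x.
apply: card_disjoint_sub; try by apply: subset_trans (subsetIl _ _) (sub _).
apply: disjointWl (subsetIr _ _) _; apply: disjointWr (subsetIr _ _) _.
by rewrite disjoints_subset setCK.
Qed.

(** * Hall's condition when one half has more than [k] faults *)

Section OverloadedHalf.
Variables (T : finType) (e : rel T) (k : nat) (V : {set T}) (c1 c2 : T -> T).
Hypothesis k_ge4 : 4 <= k.
Hypothesis robustV : robust e k V.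
Hypothesis robustW : robust e k (~: V).
Hypotheses (c1V : forall x, (c1 x \in V) = (x \notin V))
           (c2V : forall x, (c2 x \in V) = (x \notin V)).
Hypotheses (ec1 : forall x, e x (c1 x)) (ec2 : forall x, e x (c2 x)).
Hypotheses (c1_inj : injective c1) (c2_inj : injective c2).
Hypothesis c12 : forall x, c1 x != c2 x.
Variables (FV : {set T}) (FE : {set {set T}}).
Hypothesis edgeFE : is_edge_set e FE.
Hypothesis leF : #|FV| + #|FE| <= k + 2.
Hypothesis overV : k < faults V FV FE.
Variable I : {set T}.
Hypothesis liveI : I \subset ~: FV.
Hypothesis indepI : [disjoint I & nbr (del_adj e FV FE) I].
Notation r := (del_adj e FV FE).
Notation N := (nbr r).
Notation W := (~: V).
Notation FEc := [set E in FE | ~~ (E \subset V) & ~~ (E \subset W)].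

Let splitF := faults_split V FV edgeFE.

(** Let [V] have [k + j] faults, with [j] equal to [1] or [2]. The part of [I] in [V] loses at most
    [2 * j]. At most [2 - j] faults lie elsewhere, so the part in [W] gains at least [k - 2 + j],
    which suffices because [4 <= k]. *)
Lemma overloaded_hall_meet : I :&: W != set0 -> #|I| <= #|N I|.
Proof.
move=> IW_neq0; apply: leq_trans (leq_card_nbr_halves r V I).
have live U : I :&: U \subset U :\: FV.
  by rewrite setDE setIC; apply: setIS.
have leV : faults V FV FE <= k + (faults V FV FE - k) by lia.
have := robust_excess robustV edgeFE leV (live V).
have leW : faults W FV FE <= k by lia.
have disW : [disjoint I :&: W & N (I :&: W)].
  apply: disjointWl (subsetIl _ _) _; apply: disjointWr indepI.
  by apply/subsetP=> y /nbrP[x /setIP[xI _] rxy]; apply/nbrP; exists x.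
have := robust_expand robustW edgeFE leW (live W) disW IW_neq0.
have := cardsID V I; rewrite setDE; lia.
Qed.

Lemma cross_faults_outside c x :
  (forall y, (c y \in V) = (y \notin V)) -> [set x; c x] \in FE ->
  [set x; c x] \in FEc.
Proof.
move=> cV xFE; rewrite inE xFE !subUset !sub1set !inE cV.
by case: (x \in V).
Qed.

Lemma isolated_small : faults V FV FE <= k.+1 -> I \subset V ->
  N I :&: V = set0 -> #|I| <= 1.
Proof.
move=> leV sIV NV0; rewrite leqNgt; apply/negP=> I_gt1.
have live : I \subset V :\: FV by rewrite setDE subsetI sIV.
have NI0 y : y \in V -> y \in N I -> False.
  by move=> yV yN; have := in_set0 y; rewrite -NV0 inE yN yV.
(* Restoring a faulty vertex [w] would leave [k] faults and force two neighbours of [I] in [V], but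
   only [w] can be new. *)
have FV0 : FV :&: V = set0.
  apply/setP=> w; rewrite in_set0; apply/negP=> wF.
  have wI : w \notin I.
    by apply/negP=> /(subsetP liveI); case/setIP: wF; rewrite inE => ->.
  have leD1 : faults V (FV :\ w) FE <= k.
    by move: leV; rewrite (faultsD1v _ wF).
  have liveD1 := subset_trans live (setDS V (subsetDl FV [set w])).
  have := robustV edgeFE leD1 liveD1; apply/negP; rewrite -ltnNge.
  apply: leq_ltn_trans I_gt1; rewrite -(cards1 w); apply: subset_leq_card.
  apply/subsetP=> y /setIP[/(subsetP (nbrD1v _ _ _ wI))].
  by case/setU1P=> [->|yN] yV; [rewrite inE | case: (NI0 y)].
have FEI : [set E in FE | E \subset V] \subset [set I].
  apply/subsetP=> E; rewrite !inE => /andP[EFE sEV].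
  have leD1 : faults V FV (FE :\ E) <= k.
    by move: leV; rewrite (faultsD1e _ EFE sEV).
  have := robustV (edge_setD1 (E := E) edgeFE) leD1 live.
  set N' := _ :&: V => leIN'.
  have N'P y : y \in N' -> exists2 x, x \in I & E = [set x; y].
    by case/setIP=> /nbrD1e[yN yV|//]; case: (NI0 y).
  have N'E : N' = E.
    apply/eqP; rewrite eqEcard; apply/andP; split.
      by apply/subsetP=> y /N'P[x _ ->]; rewrite !inE eqxx orbT.
    exact: leq_trans (card_edge edgeFE EFE) (leq_trans I_gt1 leIN').
  (* Every end of [E] is a new neighbour, so the opposite end lies in [I]. Using this for both ends
     puts [E] inside [I], and cardinalities give equality. *)
  have [y yE] : exists y, y \in E.
    by apply/set0Pn; rewrite -card_gt0 -N'E; apply: leq_trans leIN'; apply: ltnW.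
  have [|x xI Exy] := N'P y; first by rewrite N'E.
  have [|x' x'I Ex'x] := N'P x; first by rewrite N'E Exy !inE eqxx.
  by rewrite eqEcard -{2}N'E leIN' andbT Ex'x subUset !sub1set x'I.
have := subset_leq_card FEI; rewrite cards1.
by move: overV; rewrite /faults FV0 cards0; lia.
Qed.

Lemma cross_nbr c x : e x (c x) -> x \in I -> c x \notin FV ->
  [set x; c x] \notin FE -> c x \in N I.
Proof.
move=> exc xI cFV cFE; apply/nbrP; exists x; rewrite // /del_adj exc cFV cFE.
by have := subsetP liveI x xI; rewrite inE => ->.
Qed.

Lemma overloaded_hall_sub : I \subset V -> #|I| <= #|N I|.
Proof.
move=> sIV; rewrite leqNgt; apply/negP=> ltNI.
have injN (c : T -> T) : injective c -> ~ (forall x, x \in I -> c x \in N I).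
  move=> c_inj cN; move: ltNI; rewrite ltnNge -(card_imset (mem I) c_inj).
  by rewrite subset_leq_card //; apply/subsetP=> _ /imsetP[x xI ->]; apply: cN.
have cW (c : T -> T) x :
    (forall y, (c y \in V) = (y \notin V)) -> x \in I -> c x \notin V.
  by move=> cV xI; rewrite cV (subsetP sIV).
have [FVW0|[w wF]] := set_0Vmem (FV :&: W).
  (* With no faulty vertex in [W], each matching must contain a faulty edge at [I]. At most one
     faulty edge crosses, so the two would coincide, contradicting [c12]. *)
  have bad (c : T -> T) : injective c -> (forall x, e x (c x)) ->
      (forall y, (c y \in V) = (y \notin V)) ->
      exists2 x, x \in I & [set x; c x] \in FE.
    move=> c_inj ec cV; apply/exists_inP; apply: contraT => noBad.
    case: (injN c c_inj) => x xI; apply: cross_nbr => //.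
      apply/negP=> cFV; have := in_set0 (c x).
      by rewrite -FVW0 !inE cFV cW.
    by apply: contra noBad => xFE; apply/exists_inP; exists x.
  have [x xI xFE] := bad c1 c1_inj ec1 c1V.
  have [z zI zFE] := bad c2 c2_inj ec2 c2V.
  have /card_le1_eqP/(_ [set x; c1 x] [set z; c2 z]) : #|FEc| <= 1 by lia.
  rewrite !cross_faults_outside // => /(_ isT isT) eqE.
  have : x \in [set z; c2 z] by rewrite eqE !inE eqxx.
  have : c1 x \in [set z; c2 z] by rewrite eqE !inE eqxx orbT.
  rewrite !inE => /orP[/eqP c1z|/eqP c1c2].
    by have := cW c1 x c1V xI; rewrite c1z (subsetP sIV).
  case/orP=> /eqP xz; first by have := c12 x; rewrite c1c2 xz eqxx.
  by have := cW c2 z c2V zI; rewrite -xz (subsetP sIV).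
(* Now [w] is the only fault outside those inside [V]; in particular every crossing edge is
   intact. *)
have FW_gt0 : 0 < #|FV :&: W| by rewrite card_gt0; apply/set0Pn; exists w.
have leFW : #|FV :&: W| <= faults W FV FE by apply: leq_addr.
have FEc0 : FEc = set0 by apply/eqP; rewrite -cards_eq0; lia.
have FVWw y : y \in FV -> y \notin V -> y = w.
  move=> yF yV; have /card_le1_eqP : #|FV :&: W| <= 1 by lia.
  by apply; rewrite // !inE yF.
have goodN (c : T -> T) x : (forall x, e x (c x)) ->
    (forall y, (c y \in V) = (y \notin V)) -> x \in I -> c x != w ->
    c x \in N I.
  move=> ec cV xI /eqP cw; apply: cross_nbr => //.
    by apply/negP=> /FVWw/(_ (cW c x cV xI)).
  by apply/negP=> /(cross_faults_outside cV); rewrite FEc0 inE.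
have [x xI c1x] : exists2 x, x \in I & c1 x == w.
  apply/exists_inP; apply: contraT => noBad; case: (injN c1 c1_inj) => x xI.
  by apply: goodN => //; apply: contra noBad => cw; apply/exists_inP; exists x.
have I_gt1 : 1 < #|I|.
  apply: leq_trans ltNI; rewrite ltnS card_gt0; apply/set0Pn; exists (c2 x).
  by apply: goodN => //; rewrite eq_sym -(eqP c1x).
(* The matching [c1] already gives [#|I| - 1] neighbours outside [V], and [N I] has fewer than
   [#|I|] elements, so none is left for [V]. *)
have NV0 : N I :&: V = set0.
  apply/eqP; rewrite -cards_eq0 -leqn0; have NW : c1 @: I :\ w \subset N I :\: V.
    apply/subsetP=> y /setD1P[cw /imsetP[z zI cz]]; rewrite cz in cw *.
    by rewrite in_setD goodN // cW.
  have := subset_leq_card NW; have := cardsID V (N I).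
  have := cardsD1 w (c1 @: I); rewrite card_imset //.
  by move: ltNI; case: (w \in _) => /=; lia.
by move: I_gt1; rewrite ltnNge isolated_small //; lia.
Qed.

Lemma overloaded_hall : #|I| <= #|N I|.
Proof.
have [IW0|] := eqVneq (I :&: W) set0; last exact: overloaded_hall_meet.
by apply: overloaded_hall_sub; rewrite -[V]setCK -disjoints_subset -setI_eq0 IW0.
Qed.

End OverloadedHalf.

Lemma two_halves_hall (T : finType) (e : rel T) k (V : {set T}) (c1 c2 : T -> T)
    (FV : {set T}) FE (A : {set T}) :
  symmetric e -> 4 <= k -> robust e k V -> robust e k (~: V) ->
  (forall x, (c1 x \in V) = (x \notin V)) ->
  (forall x, (c2 x \in V) = (x \notin V)) ->
  (forall x, e x (c1 x)) -> (forall x, e x (c2 x)) ->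
  injective c1 -> injective c2 -> (forall x, c1 x != c2 x) ->
  is_edge_set e FE -> #|FV| + #|FE| <= k + 2 -> A \subset ~: FV ->
  #|A| <= #|nbr (del_adj e FV FE) A|.
Proof.
move=> e_sym k_ge4 robV robW c1V c2V ec1 ec2 c1_inj c2_inj c12 edgeFE leF.
apply: hall_indep => [|I live indep]; first exact: del_adj_sym.
have [overV|leV] := ltnP k (faults V FV FE).
  exact: (overloaded_hall k_ge4 robV robW c1V c2V).
have [overW|leW] := ltnP k (faults (~: V) FV FE).
  apply: (overloaded_hall k_ge4 robW _ _ _ ec1 ec2) => //.
  - by rewrite setCK.
  - by move=> x; rewrite !inE c1V.
  - by move=> x; rewrite !inE c2V.
have liveU U : I :&: U \subset U :\: FV by rewrite setDE setIC; apply: setIS.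
apply: leq_trans (leq_card_nbr_halves _ V I).
rewrite -(cardsID V I) setDE; apply: leq_add.
  exact: robV edgeFE leV (liveU V).
exact: robW edgeFE leW (liveU (~: V)).
Qed.

(** Faults are pulled back along [i], which keeps only those inside the image. A violation of Hall's
    condition in the image would make the pulled-back faults a preclusion set of size at most
    [k]. *)
Lemma robust_embed (R : realFieldType) (T1 T : finType) (e1 : rel T1)
    (e : rel T) (i : T1 -> T) k :
  injective i -> (forall a b, e (i a) (i b) = e1 a b) -> symmetric e1 ->
  (forall FV FE, fsmp_set R e1 FV FE -> k < #|FV| + #|FE|) ->
  robust e k (i @: setT).
Proof.
move=> i_inj ei e1_sym fsmp1 FV FE A edgeFE lek sA; set U := i @: setT.
pose FV' := i @^-1: FV; pose FE' := [set E : {set T1} | i @: E \in FE].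
have im_pre (B : {set T}) : i @: (i @^-1: B) = B :&: U.
  apply/setP=> y; apply/imsetP/setIP=> [[x xB ->]|[yB /imsetP[x _ yx]]].
    by split; [rewrite inE in xB | apply: imset_f].
  by exists x; rewrite // inE -yx.
have imE (a b : T1) : i @: [set a; b] = [set i a; i b].
  by rewrite imsetU1 imset_set1.
have edgeFE' : is_edge_set e1 FE'.
  move=> E; rewrite inE => iE; have [x [y [exy iExy]]] := edgeFE _ iE.
  have [a _ xa] : exists2 a, a \in E & x = i a.
    by apply/imsetP; rewrite iExy !inE eqxx.
  have [b _ yb] : exists2 b, b \in E & y = i b.
    by apply/imsetP; rewrite iExy !inE eqxx orbT.
  exists a, b; split; first by rewrite -ei -xa -yb.
  by apply: (imset_inj i_inj); rewrite /= imE -xa -yb.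
have leF' : #|FV'| + #|FE'| <= k.
  apply: leq_trans lek; rewrite /faults -im_pre card_imset // leq_add2l.
  rewrite -(card_imset (mem FE') (imset_inj i_inj)); apply: subset_leq_card.
  apply/subsetP=> E' /imsetP[E]; rewrite inE => iE ->; rewrite inE iE.
  exact: imsetS (subsetT E).
have AE : i @: (i @^-1: A) = A.
  by rewrite im_pre; apply/setIidPl/(subset_trans sA)/subsetDl.
have del_i a b : del_adj e FV FE (i a) (i b) = del_adj e1 FV' FE' a b.
  by rewrite /del_adj !inE ei imE.
rewrite leqNgt; apply/negP=> ltNA.
suff : k < #|FV'| + #|FE'| by rewrite ltnNge leF'.
apply: fsmp1; split=> // fpm.
have liveA' : i @^-1: A \subset ~: FV'.
  apply/subsetP=> x; rewrite !inE => /(subsetP sA).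
  by rewrite inE => /andP[].
have := fpm_hall e1_sym fpm liveA'; apply/negP; rewrite -ltnNge.
rewrite -(card_imset (mem (i @^-1: A)) i_inj) AE; apply: leq_ltn_trans ltNA.
rewrite -(card_imset _ i_inj); apply: subset_leq_card.
apply/subsetP=> _ /imsetP[b /nbrP[a aA rab] ->]; rewrite in_setI imset_f // andbT.
by apply/nbrP; exists (i a); [rewrite inE in aA | rewrite del_i].
Qed.

(** * Generalized augmented cubes *)

Lemma card_set_sum (T1 T2 : finType) (P : pred (T1 + T2)) :
  #|[set z | P z]| = #|[set x | P (inl x)]| + #|[set y | P (inr y)]|.
Proof.
rewrite -!sum1_card big_sumType /=.
by congr (_ + _); apply: eq_bigl => x; rewrite !inE.
Qed.

Lemma iso_regular (T1 T2 : finType) (e1 : rel T1) (e2 : rel T2) d :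
  graph_iso e1 e2 ->
  symmetric e2 /\ (forall y, #|[set z | e2 y z]| = d) ->
  symmetric e1 /\ (forall x, #|[set z | e1 x z]| = d).
Proof.
case=> f [[g fK gK] ef] [e2_sym deg2]; split=> [x y|x].
  by rewrite -!ef e2_sym.
rewrite -(deg2 (f x)) -(card_imset _ (can_inj fK)); apply: eq_card => z.
apply/imsetP/idP=> [[y]|]; first by rewrite !inE => exy ->; rewrite ef.
by rewrite inE => ez; exists (g z); rewrite ?gK // inE -ef gK.
Qed.

Lemma gaq_join_regular (T1 T2 : finType) (e1 : rel T1) (e2 : rel T2) m1 m2 d :
  bijective m1 -> bijective m2 -> (forall x, m1 x != m2 x) ->
  symmetric e1 /\ (forall y, #|[set z | e1 y z]| = d) ->
  symmetric e2 /\ (forall y, #|[set z | e2 y z]| = d) ->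
  symmetric (gaq_join e1 e2 m1 m2) /\
  (forall x, #|[set z | gaq_join e1 e2 m1 m2 x z]| = d + 2).
Proof.
case=> g1 m1K g1K [g2 m2K g2K] m12 [sym1 deg1] [sym2 deg2].
split=> [[x|x] [y|y] //=|[x|y]]; rewrite card_set_sum /=.
  rewrite deg1; congr (_ + _); have := cards2 (m1 x) (m2 x).
  by rewrite m12 => <-; apply: eq_card => y; rewrite !inE.
rewrite deg2 addnC; congr (_ + _).
have -> : [set x | (y == m1 x) || (y == m2 x)] = [set g1 y; g2 y].
  by apply/setP=> x; rewrite !inE -(can2_eq m1K g1K) -(can2_eq m2K g2K)
     ![y == _]eq_sym.
(* If the two left partners of [y] coincided, [m1] and [m2] would agree there. *)
rewrite cards2; case: eqVneq => // eqg.
by have := m12 (g1 y); rewrite {2}eqg g1K g2K eqxx.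
Qed.

(** A concrete list, so that claims about all vertices of [AQ 4] are settled by evaluating [all] and
    [count]. *)
Fixpoint bitstrings n : seq (seq bool) :=
  if n is m.+1 then
    [seq true :: s | s <- bitstrings m] ++ [seq false :: s | s <- bitstrings m]
  else [:: [::]].

Lemma AQ4_regular : symmetric (AQ 4) /\ (forall x, #|[set y | AQ 4 x y]| = 7).
Proof.
have valE : perm_eq (map val (enum {: 4.-tuple bool})) (bitstrings 4).
  apply: uniq_perm => //; first by rewrite map_inj_uniq ?enum_uniq //; apply: val_inj.
  move=> s; apply/mapP/idP=> [[[t /= /eqP tn] _ ->]|s_in].
    by case: t tn => [|[] [|[] [|[] [|[] []]]]].
  have s4 : size s == 4.
    by move: s s_in; apply/allP.
  by exists (Tuple s4); rewrite ?mem_enum.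
have val_in (x : 4.-tuple bool) : val x \in (bitstrings 4).
  by rewrite -(perm_mem valE) map_f ?mem_enum.
split=> [x y|x].
  have : all (fun u => all (fun v => aq_adj u v == aq_adj v u) (bitstrings 4)) (bitstrings 4) by [].
  by move/allP/(_ _ (val_in x))/allP/(_ _ (val_in y))/eqP.
have : all (fun u => count (aq_adj u) (bitstrings 4) == 7) (bitstrings 4) by [].
move/allP/(_ _ (val_in x))/eqP <-; rewrite -(permP valE) count_map.
by rewrite cardsE cardE size_filter -enumT.
Qed.

Lemma GAQ_regular n (T : finType) (e : rel T) : GAQ n T e ->
  symmetric e /\ (forall x, #|[set y | e x y]| = 2 * n - 1).
Proof.
elim=> {n T e} [T e iso | n T T1 T2 e e1 e2 m1 m2 n_ge5 _ reg1 _ reg2 m1b m2b m12].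
  exact: iso_regular iso AQ4_regular.
move=> iso; have -> : 2 * n - 1 = 2 * n.-1 - 1 + 2 by lia.
exact: iso_regular iso (gaq_join_regular m1b m2b m12 reg1 reg2).
Qed.

Lemma GAQ_inhabited n (T : finType) (e : rel T) : GAQ n T e -> inhabited T.
Proof.
elim=> {n T e} [T e [f [[g _ _] _]] | n T T1 T2 e e1 e2 m1 m2 _ _ [x] _ _ _ _ _].
  by constructor; apply/g/(nseq_tuple 4 true).
by case=> f [[g _ _] _]; constructor; apply/g/inl.
Qed.

Lemma GAQ_inv n (T : finType) (e : rel T) : GAQ n T e -> 5 <= n ->
  exists (T1 T2 : finType) (e1 : rel T1) (e2 : rel T2) (m1 m2 : T1 -> T2),
    [/\ GAQ n.-1 T1 e1, GAQ n.-1 T2 e2,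
        [/\ bijective m1, bijective m2 & forall x, m1 x != m2 x]
      & graph_iso e (gaq_join e1 e2 m1 m2)].
Proof.
case=> {n T e} [//|n T T1 T2 e e1 e2 m1 m2 _ G1 G2 m1b m2b m12 iso _].
by exists T1, T2, e1, e2, m1, m2.
Qed.

(** Deleting all edges at [x] isolates it, so its weights would form an empty sum equal to [1]. With
    regularity this gives the upper bound. *)
Lemma fsmp_set_star (R : realFieldType) (T : finType) (e : rel T) x :
  exists FV FE, fsmp_set R e FV FE /\ #|FV| + #|FE| = #|[set y | e x y]|.
Proof.
exists set0, [set [set x; y] | y in [set y | e x y]]; split; last first.
  rewrite cards0 card_in_imset // => y z _ _ eqxyz.
  have : y \in [set x; z] by rewrite -eqxyz !inE eqxx orbT.
  have : z \in [set x; y] by rewrite eqxyz !inE eqxx orbT.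
  by rewrite !inE => /orP[/eqP->|/eqP->//] /orP[] /eqP->.
split=> [A /imsetP[y]|]; first by rewrite inE => exy ->; exists x, y.
case=> f [_ [_ /(_ x)]]; rewrite inE big_pred0 => [/(_ isT)/eqP|y].
  by rewrite eq_sym oner_eq0.
apply/negP=> /and4P[exy _ _ /negP]; apply; apply: imset_f.
by rewrite inE.
Qed.

Lemma GAQ_fpm (R : realFieldType) n (T : finType) (e : rel T)
    (FV : {set T}) FE :
  5 <= n ->
  (forall (T : finType) (e : rel T), GAQ n.-1 T e -> fsmp_eq R e (2 * n - 3)) ->
  GAQ n T e -> is_edge_set e FE -> #|FV| + #|FE| <= 2 * n - 2 ->
  has_fpm R e FV FE.
Proof.
move=> n_ge5 IH Ge edgeFE leF; have [e_sym _] := GAQ_regular Ge.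
have [T1 [T2 [e1 [e2 [m1 [m2 [G1 G2 [m1b m2b m12] [f [[g fK gK] ef]]]]]]]]] :=
  GAQ_inv Ge n_ge5.
have [[[g1 m1K g1K] [g2 m2K g2K]] [sym1 _] [sym2 _]] :=
  And3 (conj m1b m2b) (GAQ_regular G1) (GAQ_regular G2).
have eg u v : e (g u) (g v) = gaq_join e1 e2 m1 m2 u v by rewrite -ef !gK.
have g_inj := can_inj gK.
(* A matching [m] with inverse [h] becomes a single self-map of the vertex set that swaps the
   halves. *)
pose cross (m : T1 -> T2) (h : T2 -> T1) (x : T) : T :=
  match f x with inl a => g (inr (m a)) | inr b => g (inl (h b)) end.
pose V := (g \o inl) @: [set: T1].
have VP x : (x \in V) = (if f x is inl _ then true else false).
  apply/imsetP/idP=> [[a _ ->]|]; first by rewrite /= gK.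
  by case fx: (f x) => [a|//] _; exists a; rewrite // /= -fx fK.
have VC : ~: V = (g \o inr) @: [set: T2].
  apply/setP=> x; rewrite inE VP; apply/idP/imsetP=> [|[b _ ->]]; last by rewrite /= gK.
  by case fx: (f x) => [//|b] _; exists b; rewrite // /= -fx fK.
have crossV m h x : (cross m h x \in V) = (x \notin V).
  by rewrite !VP /cross; case: (f x) => a; rewrite gK.
have cross_inj m h : cancel m h -> cancel h m -> injective (cross m h).
  move=> mK hK x y; rewrite /cross -{2}[x]fK -{2}[y]fK.
  by case: (f x) => a; case: (f y) => b /g_inj[] // eqab; congr (g (_ _));
     [apply: (can_inj mK) | apply: (can_inj hK)].
have fsmpP (T0 : finType) (e0 : rel T0) : GAQ n.-1 T0 e0 ->
    forall FV0 FE0, fsmp_set R e0 FV0 FE0 -> 2 * n - 4 < #|FV0| + #|FE0|.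
  by move=> /IH[_ min] FV0 FE0 /min; lia.
apply: hall_fpm => // A.
(* By hypothesis each half tolerates [k = 2 * n - 4] faults, one below its preclusion number; the
   budget [2 * n - 2] is [k + 2]. *)
apply: (@two_halves_hall T e (2 * n - 4) V (cross m1 g1) (cross m2 g2)) => //.
- lia.
- apply: (robust_embed _ _ sym1 (fsmpP _ _ G1)) => [a b /g_inj[]//|a b].
  exact: eg.
- rewrite VC; apply: (robust_embed _ _ sym2 (fsmpP _ _ G2)) => [a b /g_inj[]//|a b].
  exact: eg.
- move=> x; rewrite -{1}[x]fK /cross; case: (f x) => a; rewrite eg /= ?eqxx //.
  by rewrite g1K eqxx.
- move=> x; rewrite -{1}[x]fK /cross; case: (f x) => a; rewrite eg /= ?eqxx ?orbT //.
  by rewrite g2K eqxx orbT.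
- exact: cross_inj.
- exact: cross_inj.
- move=> x; rewrite /cross; case: (f x) => a; apply/eqP=> /g_inj[] eqa.
    by have := m12 a; rewrite eqa eqxx.
  by have := m12 (g1 a); rewrite g1K eqa g2K eqxx.
- lia.
Qed.

Theorem theorem3p2 (R : realFieldType) (n : nat) (hn : 5 <= n) :
  (forall (T : finType) (e : rel T), GAQ n.-1 T e -> fsmp_eq R e (2 * n - 3)) ->
  forall (T : finType) (e : rel T), GAQ n T e -> fsmp_eq R e (2 * n - 1).
Proof.
move=> IH T e Ge; have [_ deg] := GAQ_regular Ge; split.
  have [x] := GAQ_inhabited Ge.
  by rewrite -(deg x); apply: fsmp_set_star.
move=> FV FE [edgeFE no_fpm]; rewrite leqNgt; apply/negP=> ltF; apply: no_fpm.
by apply: GAQ_fpm hn IH Ge edgeFE _; lia.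
Qed.
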